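(* Let $M$ be an $EMV$-algebra. Then the topological spaces $\mathcal{SM}(M)$ (with the weak topology of state-morphisms) and $\mathrm{MaxI}(M)$ (with the hull-kernel topology) are locally compact Hausdorff spaces such that, if $a$ is an idempotent of $M$, then $S(a)=\{s\in\mathcal{SM}(M)\mid s(a)>0\}$ and $M(a)=\{I\in\mathrm{MaxI}(M)\mid a\notin I\}$ are compact clopen subsets. If $M$ has a top element, then $\mathcal{SM}(M)$ and $\mathrm{MaxI}(M)$ are compact spaces.
   Context: An $EMV$-algebra is an algebra $(M;\vee,\wedge,\oplus,0)$ of type $(2,2,2,0)$ such that: (i) $(M;\oplus,0)$ is a commutative monoid with neutral element $0$; (ii) $(M;\vee,\wedge,0)$ is a distributive lattice with bottom element $0$; (iii) for each idempotent $a$ of $M$ (an element with $a\oplus a=a$; $\mathcal I(M)$ denotes the set of idempotents), $([0,a];\oplus,\lambda_a,0,a)$ is an $MV$-algebra, where $[0,a]=\{x\in M\mid x\le a\}$ and $\lambda_a(x)=\min\{z\in[0,a]\mid z\oplus x=a\}$; (iv) for each $x\in M$ there is $a\in\mathcal I(M)$ with $x\le a$. A top element is not assumed. An $EMV$-homomorphism is a map $f$ between $EMV$-algebras preserving $\vee,\wedge,\oplus,0$ with $f(\lambda_b(x))=\lambda_{f(b)}(f(x))$ for each idempotent $b$ and $x\in[0,b]$. A state-morphism on $M$ is an $EMV$-homomorphism $s:M\to[0,1]$ (with $[0,1]$ the standard $MV$-algebra, $x\oplus y=\min\{x+y,1\}$) such that $s(x)=1$ for some $x\in M$. $\mathcal{SM}(M)$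 is the set of state-morphisms on $M$; its weak topology is the subspace topology inherited from the product topology on $[0,1]^M$. An ideal of $M$ is a non-empty subset $I$ that is downward closed and closed under $\oplus$; it is maximal if it is proper and not properly contained in another proper ideal. $\mathrm{MaxI}(M)$ is the set of maximal ideals of $M$; the open sets of its hull-kernel topology are the sets $O(I)=\{A\in\mathrm{MaxI}(M)\mid A\not\supseteq I\}$, $I$ an ideal of $M$. A space is locally compact if every point has a compact neighborhood.
   Formalization: In the definition of an EMV-algebra, (M;⊕,0) is taken to be a commutative ordered monoid (x ≤ y implies x⊕z ≤ y⊕z), not just a commutative monoid; without this the sets O(I) need not form a topology and the claim fails. *)

(* Defs.v *)
From HB Require Import structures.
From mathcomp Require Import all_boot all_order all_algebra.
From mathcomp Require Import all_classical all_reals all_analysis.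
From mathcomp Require Import lra.

Set Implicit Arguments.
Unset Strict Implicit.
Unset Printing Implicit Defensive.

Import Order.TTheory GRing.Theory Num.Theory.
Import numFieldNormedType.Exports.

Local Open Scope classical_set_scope.
Local Open Scope order_scope.

(* The carrier of the MV-algebra is a subset [A] of the type [T]: [add] and
   [neg] are only constrained on [A]. *)
Record MV_algebra (T : Type) (A : set T) (add : T -> T -> T) (neg : T -> T)
    (zero one : T) : Prop := {
  MV_zero : A zero;
  MV_one : A one;
  MV_add : forall x y, A x -> A y -> A (add x y);
  MV_neg : forall x, A x -> A (neg x);
  MV_addA : forall x y z, A x -> A y -> A z ->
    add x (add y z) = add (add x y) z;
  MV_addC : forall x y, A x -> A y -> add x y = add y x;
  MV_add0 : forall x, A x -> add zero x = x;
  MV_negK : forall x, A x -> neg (neg x) = x;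
  MV_neg0 : neg zero = one;
  MV_add1 : forall x, A x -> add x one = one;
  MV_Luk : forall x y, A x -> A y ->
    add (neg (add (neg x) y)) y = add (neg (add (neg y) x)) x
}.

Section RelativeComplement.
Context {d : Order.disp_t} {T : bDistrLatticeType d} (add : T -> T -> T).

Definition rel_compls (a x : T) : set T := [set z | z <= a /\ add z x = a].

Definition is_rel_compl (a x : T) : set T :=
  rel_compls a x `&` lbound (rel_compls a x).

(* [rel_compl a x] is the minimum of [rel_compls a x] if it exists, and [\bot]
   otherwise. *)
Definition rel_compl (a x : T) : T := xget \bot (is_rel_compl a x).

End RelativeComplement.

(* [le_oplus2r] makes (M; oplus, 0) a commutative *ordered* monoid. Without it
   the MV-order of [0, a] may be strictly weaker than the lattice order, and
   then the sets O(I) of the hull-kernel topology need not form a topology. *)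
HB.mixin Record BDistrLattice_isEMV d T of Order.BDistrLattice d T := {
  oplus : T -> T -> T;
  oplusA : associative oplus;
  oplusC : commutative oplus;
  oplus0x : left_id \bot oplus;
  le_oplus2r : forall z x y, x <= y -> oplus x z <= oplus y z;
  rel_compl_ex : forall a x, oplus a a = a -> x <= a ->
    is_rel_compl oplus a x !=set0;
  MV_itv : forall a, oplus a a = a ->
    MV_algebra [set x | x <= a] oplus (rel_compl oplus a) \bot a;
  le_idempotent : forall x, exists2 a, oplus a a = a & x <= a
}.

#[short(type="emvType")]
HB.structure Definition EMV d :=
  { T of Order.BDistrLattice d T & BDistrLattice_isEMV d T }.

Definition is_idempotent {d} {M : emvType d} (a : M) : Prop := oplus a a = a.

Definition lambda {d} {M : emvType d} (a x : M) : M := rel_compl oplus a x.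

Record EMV_homomorphism d d' (M : emvType d) (N : emvType d') (f : M -> N)
    : Prop := {
  EMV_homU : {morph f : x y / x `|` y};
  EMV_homI : {morph f : x y / x `&` y};
  EMV_hom_oplus : {morph f : x y / oplus x y};
  EMV_hom0 : f \bot = \bot;
  EMV_hom_lambda : forall b x, is_idempotent b -> x <= b ->
    f (lambda b x) = lambda (f b) (f x)
}.

Section EMVTheory.
Context {d : Order.disp_t} {M : emvType d}.
Implicit Types x y z a b : M.

Lemma lambdaP a x : is_idempotent a -> x <= a ->
  is_rel_compl oplus a x (lambda a x).
Proof.
move=> aa xa; rewrite /lambda /rel_compl; case: xgetP => // nP.
by have [z zP] := rel_compl_ex a x aa xa; case: (nP z).
Qed.

Lemma le_oplus x y z t : x <= y -> z <= t -> oplus x z <= oplus y t.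
Proof.
move=> xy zt; apply: (le_trans (le_oplus2r z x y xy)).
by rewrite ![oplus y _]oplusC; apply: le_oplus2r.
Qed.

Lemma le_oplus_idem a x y : is_idempotent a -> x <= a -> y <= a ->
  oplus x y <= a.
Proof. by move=> aa xa ya; rewrite -aa; apply: le_oplus. Qed.

Lemma lambda_le a x : is_idempotent a -> x <= a -> lambda a x <= a.
Proof. by move=> aa xa; have [[]] := lambdaP aa xa. Qed.

Lemma lambdaK a x : is_idempotent a -> x <= a -> lambda a (lambda a x) = x.
Proof. by move=> aa xa; apply: (MV_negK (MV_itv a aa)). Qed.

Lemma le_lambda_oplus a x y : is_idempotent a -> x <= a -> y <= a ->
  x <= y <-> oplus (lambda a x) y = a.
Proof.
move=> aa xa ya; split => [xy|lxy].
  apply/le_anti/andP; split; first exact: le_oplus_idem (lambda_le _ _) ya.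
  have [[_ lx] _] := lambdaP aa xa.
  by rewrite -[leLHS]lx; apply: le_oplus.
have lxa := lambda_le aa xa.
have [_ /(_ y)] := lambdaP aa lxa.
by rewrite (lambdaK aa xa); apply; split; rewrite // oplusC.
Qed.

Lemma leI_oplus x y z : oplus x y `&` z <= oplus (x `&` z) (y `&` z).
Proof.
have [a aa] := le_idempotent (x `|` y `|` z).
rewrite !leUx -andbA => /and3P[xa ya za].
have key u v w t : u <= a -> v <= a -> w <= a -> t <= oplus u v ->
    t <= oplus u w -> t <= oplus u (v `&` w).
  move=> ua va wa tuv tuw.
  have ta : t <= a by apply: le_trans tuv _; apply: le_oplus_idem.
  have vwa : v `&` w <= a by apply: le_trans va; apply: leIl.
  have la := lambda_le aa ta.
  have sa : oplus (lambda a t) u <= a by apply: le_oplus_idem.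
  have ssa := lambda_le aa sa.
  have E v' : v' <= a ->
      t <= oplus u v' <-> lambda a (oplus (lambda a t) u) <= v'.
    move=> v'a; have uv'a : oplus u v' <= a by apply: le_oplus_idem.
    rewrite (le_lambda_oplus aa ta uv'a) (le_lambda_oplus aa ssa v'a).
    by rewrite oplusA (lambdaK aa sa).
  by apply/(E _ vwa); rewrite lexI; apply/andP; split; apply/E.
have xza : x `&` z <= a by apply: le_trans xa; apply: leIl.
have key' u v : u <= a -> v <= a -> z `&` oplus v u <= oplus u (v `&` z).
  move=> ua va; apply: key => //; first by rewrite oplusC; apply: leIr.
  apply: le_trans (leIl _ _) _; rewrite -[leLHS]oplus0x.
  exact/le_oplus/lexx/le0x.
rewrite meetC; apply: le_trans (_ : z `&` oplus y (x `&` z) <= _); last first.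
  by rewrite oplusC meetC oplusC meetC; apply: key'.
by rewrite lexI leIl /=; apply: le_trans (key' _ _ ya xa).
Qed.

End EMVTheory.

Section UnitInterval.
Variable R : realType.
Local Open Scope ring_scope.

Definition unit_interval := set_type (`[0, 1]%classic : set R).

HB.instance Definition _ :=
  Topological.copy unit_interval (set_type (`[0, 1]%classic : set R)).
HB.instance Definition _ := [isSub of unit_interval for @sval R _].
HB.instance Definition _ :=
  [SubChoice_isSubOrder of unit_interval by <: with ring_display].

Implicit Types x y z : unit_interval.

Lemma unit_interval_ge0 x : 0 <= \val x.
Proof. by have := set_mem (valP x); rewrite /= in_itv /= => /andP[]. Qed.

Lemma unit_interval_le1 x : \val x <= 1.
Proof. by have := set_mem (valP x); rewrite /= in_itv /= => /andP[]. Qed.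

Lemma unit_intervalP (r : R) : 0 <= r -> r <= 1 -> r \in (`[0, 1]%classic : set R).
Proof. by move=> r0 r1; apply/mem_set; rewrite /= in_itv /= r0 r1. Qed.

Definition unit_interval0 : unit_interval :=
  Sub 0 (unit_intervalP (lexx 0) ler01).

Lemma unit_interval_le0x x : (unit_interval0 <= x)%O.
Proof. exact: unit_interval_ge0. Qed.

HB.instance Definition _ :=
  Order.hasBottom.Build ring_display unit_interval unit_interval_le0x.

Lemma unit_oplus_subproof x y :
  Num.min (\val x + \val y) 1 \in (`[0, 1]%classic : set R).
Proof.
apply: unit_intervalP; last by rewrite ge_min lexx orbT.
by rewrite le_min ler01 addr_ge0 // unit_interval_ge0.
Qed.

Definition unit_oplus x y : unit_interval :=
  Sub (Num.min (\val x + \val y) 1) (unit_oplus_subproof x y).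

Lemma unit_oplusE x y : \val (unit_oplus x y) = Num.min (\val x + \val y) 1.
Proof. by []. Qed.

Lemma unit_interval_bounds x : 0 <= \val x <= 1.
Proof. by rewrite unit_interval_ge0 unit_interval_le1. Qed.

Lemma unit_leE x y : (x <= y)%O = (\val x <= \val y).
Proof. by []. Qed.

Lemma unit_oplusA : associative unit_oplus.
Proof.
move=> x y z; apply: val_inj; rewrite !unit_oplusE.
have := unit_interval_bounds x; have := unit_interval_bounds y.
have := unit_interval_bounds z; rewrite !minEle.
by do ![case: ifPn]; lra.
Qed.

Lemma unit_oplusC : commutative unit_oplus.
Proof. by move=> x y; apply: val_inj; rewrite !unit_oplusE addrC. Qed.

Lemma unit_oplus0x : left_id \bot%O unit_oplus.
Proof.
move=> x; apply: val_inj; rewrite unit_oplusE /= add0r.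
exact/min_idPl/unit_interval_le1.
Qed.

Lemma unit_le_oplus2r z x y : (x <= y)%O -> (unit_oplus x z <= unit_oplus y z)%O.
Proof.
rewrite !unit_leE !unit_oplusE !minEle.
by do ![case: ifPn]; lra.
Qed.

Lemma unit_idempotent x : unit_oplus x x = x <-> \val x = 0 \/ \val x = 1.
Proof.
have := unit_interval_bounds x.
move=> xb; split=> [/(congr1 val)|x01].
  by rewrite unit_oplusE minEle; case: ifPn => ? ?; [left|right]; lra.
by apply: val_inj; rewrite unit_oplusE minEle; case: ifPn; lra.
Qed.

Lemma unit_is_rel_compl a x : unit_oplus a a = a -> (x <= a)%O ->
  exists2 z, \val z = \val a - \val x & is_rel_compl unit_oplus a x = [set z].
Proof.
move=> /unit_idempotent aa; rewrite unit_leE => xa.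
have xb := unit_interval_bounds x.
have zP : \val a - \val x \in (`[0, 1]%classic : set R).
  by apply: unit_intervalP; lra.
pose z : unit_interval := Sub (\val a - \val x) zP.
have zE : \val z = \val a - \val x by [].
have zm : rel_compls unit_oplus a x z.
  split; first by rewrite unit_leE; lra.
  by apply: val_inj; rewrite unit_oplusE minEle zE; case: ifPn; lra.
have zl : lbound (rel_compls unit_oplus a x) z.
  move=> w [wa] /(congr1 val); rewrite unit_leE unit_oplusE minEle zE.
  by case: ifPn => ? ?; lra.
exists z => //; apply/seteqP; split => [w [wm wl]|_ ->]; last by split.
by apply/le_anti/andP; split; [exact: wl|exact: zl].
Qed.

Lemma unit_rel_compl_ex a x : unit_oplus a a = a -> (x <= a)%O ->
  is_rel_compl unit_oplus a x !=set0.
Proof. by move=> aa xa; have [z _ ->] := unit_is_rel_compl aa xa; exists z. Qed.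

Lemma unit_rel_complE a x : unit_oplus a a = a -> (x <= a)%O ->
  \val (rel_compl unit_oplus a x) = \val a - \val x.
Proof.
move=> aa xa; have [z <- E] := unit_is_rel_compl aa xa.
by rewrite /rel_compl E; case: xgetP => [w _ ->|/(_ z)[]].
Qed.

Lemma unit_MV_itv a : unit_oplus a a = a ->
  MV_algebra [set x | (x <= a)%O] unit_oplus (rel_compl unit_oplus a) \bot%O a.
Proof.
move=> aa; have /unit_idempotent av := aa.
have cE := unit_rel_complE aa.
have ge0 := unit_interval_ge0.
have add_le x y : (x <= a)%O -> (y <= a)%O -> (unit_oplus x y <= a)%O.
  have := unit_interval_bounds x; have := unit_interval_bounds y.
  by rewrite !unit_leE unit_oplusE minEle; case: ifPn; lra.
have neg_le x : (x <= a)%O -> (rel_compl unit_oplus a x <= a)%O.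
  by move=> xa; rewrite unit_leE cE //; have := ge0 x; lra.
split=> //=.
- by move=> x y z _ _ _; apply: unit_oplusA.
- by move=> x y _ _; apply: unit_oplusC.
- by move=> x _; apply: unit_oplus0x.
- by move=> x xa; apply: val_inj; rewrite !cE ?neg_le //; lra.
- by apply: val_inj; rewrite cE //= subr0.
- move=> x; rewrite unit_leE => xa; apply: val_inj; rewrite unit_oplusE minEle.
  by have := ge0 x; case: ifPn; lra.
move=> x y xa ya; apply: val_inj.
rewrite !unit_oplusE !cE ?add_le ?neg_le // !unit_oplusE !cE // !minEle.
have := unit_interval_bounds x; have := unit_interval_bounds y.
move: xa ya; rewrite !unit_leE.
by do ![case: ifPn]; lra.
Qed.

Lemma unit_le_idempotent x : exists2 a, unit_oplus a a = a & (x <= a)%O.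
Proof.
pose e : unit_interval := Sub 1 (unit_intervalP ler01 (lexx 1)).
exists e; last exact: unit_interval_le1.
by apply/unit_idempotent; right.
Qed.

HB.instance Definition _ := BDistrLattice_isEMV.Build ring_display unit_interval
  unit_oplusA unit_oplusC unit_oplus0x unit_le_oplus2r unit_rel_compl_ex
  unit_MV_itv unit_le_idempotent.

End UnitInterval.

Section StateMorphisms.
Variables (R : realType) (d : Order.disp_t) (M : emvType d).

Definition is_state_morphism (s : M -> unit_interval R) : Prop :=
  EMV_homomorphism s /\ exists x, \val (s x) = 1%R.

(* [{ptws M -> _}] carries the product topology, and [set_type] the subspace
   topology. *)
Definition state_morphism :=
  set_type [set s : {ptws M -> unit_interval R} | is_state_morphism s].

HB.instance Definition _ := Topological.copy state_morphism
  (set_type [set s : {ptws M -> unit_interval R} | is_state_morphism s]).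

Definition state_fun (s : state_morphism) : M -> unit_interval R := \val s.
Definition state_val (s : state_morphism) (x : M) : R := \val (state_fun s x).

End StateMorphisms.

Section Ideals.
Context {d : Order.disp_t} {M : emvType d}.
Implicit Types (I J A : set M) (x y : M).

Definition is_ideal I : Prop :=
  [/\ I !=set0, (forall x y, x <= y -> I y -> I x) &
      forall x y, I x -> I y -> I (oplus x y)].

Definition proper_ideal I : Prop := is_ideal I /\ I <> setT.

Definition is_maximal_ideal A : Prop :=
  proper_ideal A /\ ~ exists2 J, proper_ideal J & A `<` J.

Lemma is_ideal_bigcap (F : set (set M)) :
  (forall J, F J -> is_ideal J) -> is_ideal (\bigcap_(J in F) J).
Proof.
move=> idF; split.
- exists \bot => J /idF[[x Jx] Jd _]; exact: Jd (le0x x) Jx.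
- move=> x y xy Iy J FJ; have [_ Jd _] := idF _ FJ.
  exact: Jd xy (Iy _ FJ).
- move=> x y Ix Iy J FJ; have [_ _ Ja] := idF _ FJ.
  exact: Ja (Ix _ FJ) (Iy _ FJ).
Qed.

Lemma is_ideal0 I : is_ideal I -> I \bot.
Proof. by case=> -[x Ix] Id _; apply: Id Ix; apply: le0x. Qed.

Lemma maximal_ideal_prime A x y :
  is_maximal_ideal A -> A (x `&` y) -> A x \/ A y.
Proof.
move=> [[idA AT] Amax] Axy; apply: contrapT => /not_orP[nAx nAy].
have [_ Ad Aa] := idA.
pose J : set M := [set z | A (z `&` y)].
have idJ : is_ideal J.
  split.
  - by exists x.
  - by move=> u v uv; apply: Ad; apply: leI2.
  - move=> u v Ju Jv; exact: Ad (leI_oplus u v y) (Aa _ _ Ju Jv).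
case: Amax; exists J; first split=> //.
  move=> JT; apply: nAy; have : J y by rewrite JT.
  by rewrite /J /= meetxx.
split; last by move=> JA; apply: nAx; exact: JA.
by move=> z; apply: Ad; apply: leIl.
Qed.

End Ideals.

Section HullKernel.
Context {d : Order.disp_t} (M : emvType d).

Definition maximal_ideal := set_type [set A : set M | is_maximal_ideal A].

HB.instance Definition _ := Choice.copy maximal_ideal
  (set_type [set A : set M | is_maximal_ideal A]).

Definition ideal_set (A : maximal_ideal) : set M := \val A.

Definition hull_kernel (I : set M) : set maximal_ideal :=
  [set A | ~ I `<=` ideal_set A].

Definition hull_kernel_open : set (set maximal_ideal) :=
  [set U | exists2 I, is_ideal I & U = hull_kernel I].

Lemma maximal_idealP (A : maximal_ideal) : is_maximal_ideal (ideal_set A).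
Proof. exact: set_mem (valP A). Qed.

Lemma hull_kernelT : hull_kernel_open setT.
Proof.
exists setT; first by split=> //; exists \bot.
apply/seteqP; split=> // A _ TA; have [[_ AT] _] := maximal_idealP A.
by apply: AT; apply/seteqP; split.
Qed.

Lemma hull_kernelI : setI_closed hull_kernel_open.
Proof.
move=> _ _ [I idI ->] [J idJ ->]; exists (I `&` J).
  have [_ Id Ia] := idI; have [_ Jd Ja] := idJ; split.
  - by exists \bot; split; apply: is_ideal0.
  - by move=> x y xy [Iy Jy]; split; [exact: Id xy Iy|exact: Jd xy Jy].
  - by move=> x y [Ix Jx] [Iy Jy]; split; [exact: Ia|exact: Ja].
apply/seteqP; split=> A /=; last first.
  by move=> nA; split=> sA; apply: nA => x [? ?]; exact: sA.
move=> [/existsNP[x /not_implyP[Ix nAx]] /existsNP[y /not_implyP[Jy nAy]]] sA.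
have [_ Id _] := idI; have [_ Jd _] := idJ.
have /(maximal_ideal_prime (maximal_idealP A))[] // : ideal_set A (x `&` y).
by apply: sA; split; [exact: Id (leIl _ _) Ix|exact: Jd (leIr _ _) Jy].
Qed.

Lemma hull_kernel_bigU (K : Type) (U : K -> set maximal_ideal) :
  (forall k, hull_kernel_open (U k)) -> hull_kernel_open (\bigcup_k U k).
Proof.
move=> /(_ _)/cid2-/all_sig2[I idI UE].
pose F : set (set M) := [set J | is_ideal J /\ forall k, I k `<=` J].
have idF J : F J -> is_ideal J by case.
exists (\bigcap_(J in F) J); first exact: is_ideal_bigcap.
apply/seteqP; split=> [A [k _]|A nA].
  rewrite UE => nA sA; apply: nA => x Ix; apply: sA => J [_ IJ]; exact: IJ Ix.
apply: contrapT => nU; apply: nA => x; apply.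
have [[idA _] _] := maximal_idealP A; split=> // k y Iy.
apply: contrapT => nAy; apply: nU; exists k => //; rewrite UE => sA.
by apply: nAy; apply: sA.
Qed.

HB.instance Definition _ := @isOpenTopological.Build maximal_ideal
  hull_kernel_open hull_kernelT hull_kernelI hull_kernel_bigU.

Lemma open_hull_kernel : @open maximal_ideal = hull_kernel_open.
Proof. by []. Qed.

End HullKernel.

(* Main.v *)
Require Import Defs.
From mathcomp Require Import all_boot all_order all_algebra.
From mathcomp Require Import all_classical all_reals all_analysis.

Set Implicit Arguments.
Unset Strict Implicit.
Unset Printing Implicit Defensive.

Import Order.TTheory GRing.Theory Num.Theory.
Import numFieldNormedType.Exports.

(** Everything rests on the sets attached to idempotents [a]: the states with
    [s a > 0] and the maximal ideals missing [a]. They cover both spaces, because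
    every element lies below an idempotent: one above a witness of [s x = 1] has
    state [1], and one above an element outside a proper ideal is again outside
    it. So once both spaces are Hausdorff and these sets are compact and open,
    local compactness and clopenness follow; and a top element is an idempotent
    whose set is the whole space.

    For state-morphisms, the homomorphism identities are equations between
    continuous functions of finitely many values of [f], so the homomorphisms
    [M -> [0, 1]] form a closed subset of the compact product [0, 1]^M, hence
    a compact Hausdorff space ([closed_EMV_homomorphism]). A homomorphism takes
    only the values [0] and [1] on an idempotent, so [s a > 0] amounts to the
    closed condition [s a = 1], which also guarantees that a limit of such states
    is again a state ([compact_state_gt0]).

    For maximal ideals, two facts about EMV-algebras are needed.
    [maximal_ideal_separation] gives, for distinct [A] and [B], elements
    [u] outside [B] and [v] outside [A] with [u /\ v = 0]; since maximal ideals
    are prime, no maximal ideal misses both, and the space is Hausdorff. It comes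
    from the prelinearity [(p - q) /\ (q - p) = 0] of truncated differences.
    [maximal_ideal_avoiding] extends an ideal that misses an idempotent [a] to a
    maximal ideal that still misses [a]. Compactness then follows by applying it
    to the ideal [J] of those [x] that belong to almost all maximal ideals for
    a filter [F]: a maximal ideal above [J] missing [a] is a cluster point of [F]
    ([compact_hull_kernel_idempotent]). *)

Local Open Scope classical_set_scope.
Local Open Scope ring_scope.

(** * Truncated difference in the intervals below an idempotent *)

Section RelativeDifference.
Local Open Scope order_scope.
Context {d : Order.disp_t} {M : emvType d}.
Implicit Types a e m w x y z : M.

(** The MV-algebra difference of [0, a]; in the unit interval with [a = 1] it is
    [max (x - y) 0]. *)
Definition rel_diff a x y : M := lambda a (oplus (lambda a x) y).

Lemma rel_diff_le_top a x y : is_idempotent a -> x <= a -> y <= a ->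
  rel_diff a x y <= a.
Proof.
by move=> aa xa ya; apply/lambda_le/le_oplus_idem => //; apply: lambda_le.
Qed.

(** Residuation: subtraction of [y] is left adjoint to addition of [y]. *)
Lemma rel_diffP a x y z : is_idempotent a -> x <= a -> y <= a -> z <= a ->
  x <= oplus y z <-> rel_diff a x y <= z.
Proof.
move=> aa xa ya za.
have sa : oplus (lambda a x) y <= a by apply: le_oplus_idem (lambda_le _ _) ya.
rewrite (le_lambda_oplus aa xa (le_oplus_idem aa ya za)).
by rewrite (le_lambda_oplus aa (lambda_le aa sa) za) oplusA (lambdaK aa sa).
Qed.

Lemma le_oplusl x y : x <= oplus x y.
Proof. by rewrite -[leLHS]oplus0x oplusC; exact/le_oplus/le0x. Qed.

Lemma lambdaS a x y : is_idempotent a -> x <= a -> y <= a -> x <= y ->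
  lambda a y <= lambda a x.
Proof.
move=> aa xa ya /(le_lambda_oplus aa xa ya) xy.
by apply/(le_lambda_oplus aa) => //; rewrite ?lambda_le// lambdaK// oplusC.
Qed.

Lemma lambda_top a : is_idempotent a -> lambda a a = \bot.
Proof.
move=> aa; rewrite -[RHS](lambdaK aa (le0x a)).
by congr (lambda a _); rewrite [RHS](MV_neg0 (MV_itv a aa)).
Qed.

(** The Lukasiewicz axiom, with one of its two sides collapsing when [y <= x]. *)
Lemma rel_diffK a x y : is_idempotent a -> x <= a -> y <= x ->
  oplus (rel_diff a x y) y = x.
Proof.
move=> aa xa yx; have ya := le_trans yx xa.
rewrite /rel_diff [LHS](MV_Luk (MV_itv a aa) xa ya).
have /(le_lambda_oplus aa ya xa) -> := yx.
by rewrite -/(lambda a a) lambda_top// oplus0x.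
Qed.

Lemma rel_diff_le_lambda a x y : is_idempotent a -> x <= a -> y <= a ->
  rel_diff a x y <= lambda a y.
Proof.
move=> aa xa ya; apply: lambdaS => //; last by rewrite oplusC; exact: le_oplusl.
by apply: le_oplus_idem => //; apply: lambda_le.
Qed.

(** Below the complement of [m] the sum [m + w] does not truncate, so [m] can be
    cancelled: [m + w = m] forces [w = 0]. *)
Lemma oplus_absorb_eq0 a m w : is_idempotent a -> m <= a -> w <= lambda a m ->
  oplus m w <= m -> w = \bot.
Proof.
move=> aa ma wm mwm; have lma := lambda_le aa ma; have wa := le_trans wm lma.
have mw : oplus m w = m by apply/le_anti; rewrite mwm le_oplusl.
have := MV_Luk (MV_itv a aa) (lambda_le aa wa) ma.
rewrite -!/(lambda a _) lambdaK// [oplus w m]oplusC mw.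
have /(le_lambda_oplus aa ma ma) -> := lexx m.
rewrite [oplus (lambda a m) _]oplusC.
have /(le_lambda_oplus aa wa lma) -> := wm.
by rewrite lambda_top// oplus0x => lwa; rewrite -(lambdaK aa wa) -lwa lambda_top.
Qed.

(** With [m = x /\ y], both differences are at most [x - m] and [y - m], so adding
    their meet [w] to [m] stays below [x] and below [y], that is below [m].
    Cancelling [m] leaves [w = 0]. *)
Lemma rel_diff_disjoint a x y : is_idempotent a -> x <= a -> y <= a ->
  rel_diff a x y `&` rel_diff a y x = \bot.
Proof.
move=> aa xa ya; pose m := x `&` y.
have ma : m <= a by apply: le_trans xa; apply: leIl.
have mx : m <= x by apply: leIl.
have my : m <= y by apply: leIr.
have sub u v : u <= a -> v <= a -> m <= v -> rel_diff a u v <= rel_diff a u m.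
  move=> ua va mv; have lua := lambda_le aa ua.
  by apply: lambdaS => //; [exact: le_oplus_idem..|exact: le_oplus].
apply: (oplus_absorb_eq0 aa ma).
  apply: le_trans (leIl _ _) _; apply: le_trans (sub _ _ xa ya my) _.
  exact: rel_diff_le_lambda.
rewrite /m lexI -/m; apply/andP; split.
  rewrite -[leRHS](rel_diffK aa xa mx) oplusC; apply: le_oplus => //.
  exact: le_trans (leIl _ _) (sub _ _ xa ya my).
rewrite -[leRHS](rel_diffK aa ya my) oplusC; apply: le_oplus => //.
exact: le_trans (leIr _ _) (sub _ _ ya xa mx).
Qed.

(** Idempotents are Boolean: their complements in larger idempotents are lattice
    complements. *)
Lemma idempotent_lambda_disjoint e a : is_idempotent e -> is_idempotent a ->
  a <= e -> a `&` lambda e a = \bot.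
Proof.
move=> ee aa ae; apply: (oplus_absorb_eq0 ee ae); first exact: leIr.
by apply: le_oplus_idem => //; apply: leIl.
Qed.

End RelativeDifference.

(** * Existence and separation of maximal ideals *)

Section MaximalIdeals.
Local Open Scope order_scope.
Context {d : Order.disp_t} {M : emvType d}.
Implicit Types (a x y : M) (A B J : set M).

Lemma proper_ideal_misses_idempotent A x : Defs.proper_ideal A ->
  exists a, [/\ is_idempotent a, x <= a & ~ A a].
Proof.
move=> [[_ Ad _] AT]; have [y nAy] : exists y, ~ A y.
  by apply: contrapT => /forallNP nA; apply: AT; apply/seteqP; split=> // y _;
    exact: contrapT (nA y).
have [a aa] := le_idempotent (x `|` y); rewrite leUx => /andP[xa ya].
by exists a; split=> // Aa; apply: nAy; exact: Ad ya Aa.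
Qed.

Lemma maximal_ideal_eq A J : is_maximal_ideal A -> Defs.proper_ideal J ->
  A `<=` J -> J = A.
Proof.
move=> [_ Amax] pJ AJ; apply/seteqP; split=> // x Jx; apply: contrapT => nAx.
by apply: Amax; exists J => //; split=> // JA; apply: nAx; exact: JA.
Qed.

(** By maximality [A] and [B] together generate [M], so some idempotent [a] outside
    both is at most [p + q] with [p] in [A] and [q] in [B]. Were [p - q] in [B],
    then [p], being below [q + (p - q)], and with it [a] would be in [B];
    symmetrically [q - p] is not in [A]. *)
Lemma maximal_ideal_separation A B : is_maximal_ideal A -> is_maximal_ideal B ->
  A <> B -> exists u v, [/\ u `&` v = \bot, ~ B u & ~ A v].
Proof.
move=> mA mB AB; have [pA _] := mA; have [pB _] := mB.
have [[_ Ad Aa] _] := pA; have [[_ Bd Ba] _] := pB.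
have A0 := is_ideal0 pA.1; have B0 := is_ideal0 pB.1.
pose J : set M := [set z | exists p q, [/\ A p, B q & z <= oplus p q]].
have JT : J = setT.
  apply: contrapT => JT; have pJ : Defs.proper_ideal J.
    split=> //; split.
    - by exists \bot, \bot, \bot; rewrite le0x.
    - move=> x y xy [p [q [Ap Bq ypq]]]; exists p, q; split=> //.
      exact: le_trans ypq.
    - move=> x y [p [q [Ap Bq xpq]]] [p' [q' [Ap' Bq' ypq]]].
      exists (oplus p p'), (oplus q q'); split; [exact: Aa|exact: Ba|].
      apply: le_trans (le_oplus xpq ypq) _.
      by rewrite !oplusA -[oplus (oplus p q) p']oplusA [oplus q p']oplusC oplusA.
  apply: AB; rewrite -(maximal_ideal_eq mA pJ); last first.
    by move=> x Ax; exists x, \bot; rewrite le_oplusl.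
  apply: maximal_ideal_eq => // x Bx.
  by exists \bot, x; rewrite oplus0x.
have [y [_ _ nAy]] := proper_ideal_misses_idempotent \bot pA.
have [a [aa ya nBa]] := proper_ideal_misses_idempotent y pB.
have nAa : ~ A a by move=> Aa'; apply: nAy; exact: Ad ya Aa'.
have [p [q [Ap Bq apq]]] : J a by rewrite JT.
(* Truncate at [a], so that differences can be taken inside [0, a]. *)
have pa : p `&` a <= a by apply: leIr.
have qa : q `&` a <= a by apply: leIr.
have apq' : a <= oplus (p `&` a) (q `&` a).
  by apply: le_trans (leI_oplus p q a); rewrite lexI apq /=.
have Ap' : A (p `&` a) by apply: Ad Ap; apply: leIl.
have Bq' : B (q `&` a) by apply: Bd Bq; apply: leIl.
have diffK x y' : x <= a -> y' <= a -> x <= oplus y' (rel_diff a x y').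
  by move=> xa y'a; apply/(rel_diffP aa) => //; exact: rel_diff_le_top.
exists (rel_diff a (p `&` a) (q `&` a)), (rel_diff a (q `&` a) (p `&` a)).
split; first exact: rel_diff_disjoint.
- move=> Bu; apply: nBa; apply: (Bd _ _ apq'); apply: (Ba _ _ _ Bq').
  exact: Bd (diffK _ _ pa qa) (Ba _ _ Bq' Bu).
- move=> Av; apply: nAa; apply: (Ad _ _ apq'); apply: (Aa _ _ Ap').
  exact: Ad (diffK _ _ qa pa) (Aa _ _ Ap' Av).
Qed.

(** Zorn gives an ideal [A] containing [J] and maximal among those missing [a]. It
    is a maximal ideal: by maximality it contains every [x] with [x /\ a = 0], in
    particular the complement of [a] in any idempotent [e] above [a]. An ideal
    that strictly contains [A] contains [a], hence also [e], and the idempotents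
    [e] are cofinal in [M]. *)
Lemma maximal_ideal_avoiding J a : is_ideal J -> is_idempotent a -> ~ J a ->
  exists A, [/\ is_maximal_ideal A, J `<=` A & ~ A a].
Proof.
move=> idJ aa nJa.
(* The inclusion of [J] is asked of non-empty sets only, so that the union of the
   empty chain satisfies [P]. *)
pose P (X : set M) := [/\ forall x y, x <= y -> X y -> X x,
  forall x y, X x -> X y -> X (oplus x y), ~ X a & X !=set0 -> J `<=` X].
have [F FP totF|A [[Ad Aa nAa AJ] Amax]] := @Zorn_bigcup _ P.
  split.
  - move=> x y xy [X FX Xy]; exists X => //.
    by have [Xd _ _ _] := FP _ FX; exact: Xd xy Xy.
  - move=> x y [X FX Xx] [Y FY Yy].
    have [XY|YX] := totF _ _ FX FY.
      exists Y => //; have [_ Ya _ _] := FP _ FY; exact: Ya (XY _ Xx) Yy.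
    exists X => //; have [_ Xa _ _] := FP _ FX; exact: Xa Xx (YX _ Yy).
  - by move=> [X FX Xa]; have [_ _ nXa _] := FP _ FX.
  - move=> [x [X FX Xx]]; have [_ _ _ XJ] := FP _ FX.
    by move=> y Jy; exists X => //; apply: XJ => //; exists x.
have [J0 Jd Ja] := idJ.
have {}AJ : J `<=` A.
  apply: contrapT => nJA.
  have A0 : A = set0.
    by apply/seteqP; split=> // x Ax; apply: nJA; apply: AJ; exists x.
  apply: (Amax J); last by split=> // _ x.
  by split; rewrite A0 //; case: J0 => x Jx /(_ x Jx).
have idA : is_ideal A by split=> //; case: J0 => x /AJ; exists x.
exists A; split=> //; split.
  by split=> // AT; apply: nAa; rewrite AT.
move=> [K [[K0 Kd Ka] KT] AK].
have Ka' : K a.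
  apply: contrapT => nKa; apply: (Amax K AK); split=> // _.
  by move=> x /AJ Ax; exact: AK.1.
(* Otherwise the ideal of the [z] with [z /\ a] in [A] would be larger than [A]
   and still miss [a]. *)
have disjA x : x `&` a = \bot -> A x.
  move=> xa0; apply: contrapT => nAx.
  apply: (Amax [set z | A (z `&` a)]).
    split; first by move=> z; apply: Ad; apply: leIl.
    by move=> sub; apply/nAx/sub; rewrite /= xa0; exact: is_ideal0.
  split=> /=.
  - by move=> y z yz; apply: Ad; apply: leI2.
  - by move=> y z Ay Az; exact: Ad (leI_oplus y z a) (Aa _ _ Ay Az).
  - by rewrite meetxx.
  - by move=> _ z /AJ; apply: Ad; apply: leIl.
apply: KT; apply/seteqP; split=> // x _.
have [e ee] := le_idempotent (x `|` a); rewrite leUx => /andP[xe ae].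
apply: Kd xe _; have /(le_lambda_oplus ee ae ae) <- := lexx a.
apply: Ka => //; apply: AK.1; apply: disjA.
by rewrite meetC; exact: idempotent_lambda_disjoint.
Qed.

End MaximalIdeals.

(** * The hull-kernel topology *)

Section HullKernelTopology.
Context {d : Order.disp_t} {M : emvType d}.
Implicit Types (a u : M).

(** This is the open set of the principal ideal of [u], obtained as the
    intersection of all ideals containing [u]. *)
Lemma open_hull_kernel1 u : open [set A : maximal_ideal M | ~ ideal_set A u].
Proof.
rewrite open_hull_kernel.
exists (\bigcap_(J in [set J | is_ideal J /\ J u]) J).
  by apply: is_ideal_bigcap => J [].
apply/seteqP; split=> A /= nA sA; apply: nA; first by apply: sA => J [].
by move=> x; apply; split=> //; case: (maximal_idealP A) => -[].
Qed.

Lemma maximal_ideal_hausdorff : hausdorff_space (maximal_ideal M).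
Proof.
rewrite open_hausdorff => A B AB.
have [|u [v [uv0 nBu nAv]]] :=
    maximal_ideal_separation (maximal_idealP A) (maximal_idealP B).
  by move=> /val_inj/eqP; rewrite (negPf AB).
exists ([set C | ~ ideal_set C v], [set C | ~ ideal_set C u]).
  by rewrite !inE.
split; [exact: open_hull_kernel1|exact: open_hull_kernel1|].
apply/eqP/seteqP; split=> // C [/= nCv nCu].
have mC := maximal_idealP C.
have /(maximal_ideal_prime mC)[] // : ideal_set C (u `&` v)%O.
by rewrite uv0; apply: is_ideal0; case: mC => -[].
Qed.

(** Given a filter [F] of such maximal ideals, let [J] consist of the [x] that belong to
    [F]-almost all of them; it misses [a]. A maximal ideal [B] above [J] missing [a]
    is a cluster point of [F]: if a basic neighbourhood of [B] given by [I] did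
    not meet some member of [F], all ideals in that member would contain [I], so
    [I] would be included in [J] and in [B]. *)
Lemma compact_hull_kernel_idempotent a : is_idempotent a ->
  compact [set A : maximal_ideal M | ~ ideal_set A a].
Proof.
move=> aa F PF Fa; pose J : set M := [set x | F [set A | ideal_set A x]].
have idA (A : maximal_ideal M) : is_ideal (ideal_set A).
  by case: (maximal_idealP A) => -[].
have idJ : is_ideal J.
  split.
  - by exists \bot%O; apply: filterS filterT => A _; exact: is_ideal0.
  - move=> x y xy; apply: filterS => A /=.
    by case: (idA A) => _ + _; apply.
  - move=> x y Fx Fy; apply: filterS2 Fx Fy => A /=.
    by case: (idA A) => _ _; apply.
have nJa : ~ J a.
  by move=> Ja; case: (filter_ex (filterI Fa Ja)) => A [].
have [B [mB JB nBa]] := maximal_ideal_avoiding idJ aa nJa.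
pose b : maximal_ideal M := exist _ B (mem_set mB).
exists b; split=> // G U FG.
rewrite nbhsE => -[V [oV bV] VU].
move: oV; rewrite open_hull_kernel => -[I _ VE].
apply: contrapT => /nonemptyPn GU0; move: bV; rewrite VE; apply => x Ix.
apply: JB; apply: filterS FG => A GA; apply: contrapT => nAx.
suff : (G `&` U) A by rewrite GU0.
by split=> //; apply: VU; rewrite VE => IA; apply: nAx; exact: IA.
Qed.

Lemma clopen_hull_kernel_idempotent a : is_idempotent a ->
  clopen [set A : maximal_ideal M | ~ ideal_set A a].
Proof.
move=> aa; split; first exact: open_hull_kernel1.
apply: compact_closed; first exact: maximal_ideal_hausdorff.
exact: compact_hull_kernel_idempotent.
Qed.

End HullKernelTopology.

(** * State-morphisms as a subspace of the product of unit intervals *)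

Lemma compact_initial (S : choiceType) (T : topologicalType) (f : S -> T)
    (K : set T) : compact K -> K `<=` range f ->
  compact (f @^-1` K : set (initial_topology f)).
Proof.
move=> cK Kf F PF FK; pose g : initial_topology f -> T := f.
have [p [Kp clp]] : K `&` cluster (g @ F) !=set0 by apply: cK.
have [s _ fsp] := Kf _ Kp; exists s; split; first by rewrite /= fsp.
move=> G U FG [_ [[V oV <-] Vs VU]].
have [_ [[t Gt <-] Vt]] : (g @` G) `&` V !=set0.
  apply: clp; first exact: (@filterS _ F _ G _ (@preimage_image _ _ g G) FG).
  by rewrite -fsp; exact: open_nbhs_nbhs.
by exists t; split=> //; exact: VU.
Qed.

Lemma closed_forall (T : topologicalType) (I : Type) (P : I -> set T) :
  (forall i, closed (P i)) -> closed [set t | forall i, P i t].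
Proof.
move=> cP; rewrite (_ : mkset _ = \bigcap_i P i); last first.
  by apply/seteqP; split=> t Pt i; [move=> _|]; exact: Pt.
exact: closed_bigI.
Qed.

Lemma closed_eq_fun (R : realType) (T : topologicalType) (f g : T -> R) :
  continuous f -> continuous g -> closed [set t | f t = g t].
Proof.
move=> cf cg; rewrite (_ : mkset _ = (f \- g) @^-1` [set x | x = 0]); last first.
  apply/seteqP; split=> t /=; first by move=> ->; rewrite subrr.
  by move/eqP; rewrite subr_eq0 => /eqP.
apply: preimage_closed; last exact: closed_eq.
by move=> t _; apply: cvgB; [exact: cf|exact: cg].
Qed.

Section StateMorphismTopology.
Variables (R : realType) (d : Order.disp_t) (M : emvType d).
Implicit Types (a b x y : M).

Local Notation U := (unit_interval R).

Lemma unit_valU (x y : U) : \val (x `|` y)%O = Num.max (\val x) (\val y).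
Proof. by rewrite joinEtotal !maxEle unit_leE; case: ifP. Qed.

Lemma unit_valI (x y : U) : \val (x `&` y)%O = Num.min (\val x) (\val y).
Proof. by rewrite meetEtotal !minEle unit_leE; case: ifP. Qed.

Lemma unit_lambdaE (b x : U) : is_idempotent b -> (x <= b)%O ->
  \val (lambda b x) = \val b - \val x.
Proof. exact: unit_rel_complE. Qed.

Lemma compact_unit_interval : compact [set: U].
Proof.
have := @compact_initial _ _ (@set_val R `[0, 1]%classic) _
  (@segment_compact R 0 1).
set K := _ @^-1` _; rewrite (_ : K = setT).
  apply=> r r01; by exists (exist _ r (mem_set r01)).
by apply/seteqP; split=> // x _; exact: set_mem (valP x).
Qed.

Lemma compact_ptws_unit_interval : compact [set: {ptws M -> U}].
Proof.
have := @tychonoff M (fun=> U) (fun=> setT) (fun=> compact_unit_interval).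
by congr compact; apply/seteqP; split.
Qed.

Lemma unit_val_continuous : continuous (\val : U -> R).
Proof. exact: initial_continuous. Qed.

Lemma eval_continuous x : continuous (fun f : {ptws M -> U} => \val (f x)).
Proof.
move=> f; apply: (@continuous_comp _ _ _ (fun f : {ptws M -> U} => f x)).
  exact: (@proj_continuous M (fun=> U) x).
exact: unit_val_continuous.
Qed.

(** Real-valued form of the homomorphism identities, in which both sides of each
    equation are visibly continuous for pointwise convergence. *)
Lemma EMV_homomorphism_evalP (f : M -> U) :
  EMV_homomorphism f <->
  [/\ forall x y, \val (f (x `|` y)%O) = Num.max (\val (f x)) (\val (f y)),
      forall x y, \val (f (x `&` y)%O) = Num.min (\val (f x)) (\val (f y)),
      forall x y, \val (f (oplus x y)) = Num.min (\val (f x) + \val (f y)) 1,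
      \val (f \bot%O) = 0 &
      forall b x, is_idempotent b -> (x <= b)%O ->
        \val (f (lambda b x)) = \val (f b) - \val (f x)].
Proof.
have idem b : f (oplus b b) = oplus (f b) (f b) -> is_idempotent b ->
    is_idempotent (f b) by rewrite /is_idempotent => <- ->.
have mono x b : f (x `|` b)%O = (f x `|` f b)%O -> (x <= b)%O -> (f x <= f b)%O.
  by move=> fU xb; rewrite leEjoin -fU (join_r xb).
split=> [[fU fI fD f0 fL]|[fU fI fD f0 fL]].
  split=> [x y|x y|x y||b x bb xb].
  - by rewrite fU unit_valU.
  - by rewrite fI unit_valI.
  - by rewrite fD.
  - by rewrite f0.
  - by rewrite fL// unit_lambdaE//; [exact: idem|exact: mono].
have {}fU : {morph f : x y / (x `|` y)%O}.
  by move=> x y; apply: val_inj; rewrite fU unit_valU.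
have {}fD : {morph f : x y / oplus x y}.
  by move=> x y; apply: val_inj; rewrite fD.
split=> // [x y||b x bb xb]; apply: val_inj => //.
  by rewrite fI unit_valI.
by rewrite fL// unit_lambdaE//; [exact: idem|exact: mono].
Qed.

Lemma closed_EMV_homomorphism :
  closed [set f : {ptws M -> U} | EMV_homomorphism f].
Proof.
pose E x (f : {ptws M -> U}) : R := \val (f x).
have cE x : continuous (E x) := eval_continuous (x := x).
rewrite (_ : mkset _ =
    [set f | forall x y, E (x `|` y)%O f = (E x \max E y) f] `&`
    [set f | forall x y, E (x `&` y)%O f = (E x \min E y) f] `&`
    [set f | forall x y, E (oplus x y) f = ((E x \+ E y) \min cst 1) f] `&`
    [set f | E \bot%O f = cst 0 f] `&`
    [set f | forall b x, is_idempotent b -> (x <= b)%O ->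
      E (lambda b x) f = (E b \- E x) f]); last first.
  apply/seteqP; split=> f /=; first by move/EMV_homomorphism_evalP=> [].
  by move=> [[[[? ?] ?] ?] ?]; apply/EMV_homomorphism_evalP.
have c1 : continuous (cst 1 : {ptws M -> U} -> R) by exact: cst_continuous.
apply: closedI; first (apply: closedI;
  first (apply: closedI; first apply: closedI)).
- do 2 apply: closed_forall => ?; apply: closed_eq_fun => //.
  exact: max_fun_continuous.
- do 2 apply: closed_forall => ?; apply: closed_eq_fun => //.
  exact: min_fun_continuous.
- do 2 apply: closed_forall => ?; apply: closed_eq_fun => //.
  apply: min_fun_continuous => //.
  by move=> f; exact: continuousD (cE _ f) (cE _ f).
- by apply: closed_eq_fun => //; exact: cst_continuous.
- do 4 apply: closed_forall => ?; apply: closed_eq_fun => //.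
  by move=> f; exact: continuousB (cE _ f) (cE _ f).
Qed.

Lemma state_val_continuous x :
  continuous (fun s : state_morphism R M => state_val s x).
Proof.
move=> s; apply: (@continuous_comp (state_morphism R M) {ptws M -> U} R
  (@state_fun R d M) (fun f => \val (f x))); last exact: eval_continuous.
exact: initial_continuous.
Qed.

Lemma state_morphismP (s : state_morphism R M) :
  is_state_morphism (state_fun s).
Proof. exact: set_mem (valP s). Qed.

Lemma state_val_idempotent (s : state_morphism R M) a : is_idempotent a ->
  state_val s a = 0 \/ state_val s a = 1.
Proof.
move=> aa; have [hs _] := state_morphismP s; apply/unit_idempotent.
by rewrite -[in RHS]aa (EMV_hom_oplus hs).
Qed.

Lemma state_val_gt0 (s : state_morphism R M) a : is_idempotent a ->
  0 < state_val s a <-> state_val s a = 1.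
Proof.
by move=> aa; case: (state_val_idempotent s aa) => ->; rewrite ?ltxx ?ltr01//;
  split=> // /esym/eqP; rewrite oner_eq0.
Qed.

Lemma state_val_le (s : state_morphism R M) x y : (x <= y)%O ->
  state_val s x <= state_val s y.
Proof.
move=> xy; have [/EMV_homomorphism_evalP[sU _ _ _ _] _] := state_morphismP s.
by rewrite -(join_r xy) /state_val sU le_max lexx.
Qed.

Lemma state_morphism_hausdorff : hausdorff_space (state_morphism R M).
Proof.
move=> s t st; apply: val_inj; apply/funext => x; apply: val_inj.
apply: Rhausdorff => A B nA nB.
have [u [Au Bu]] := st _ _ (state_val_continuous nA) (state_val_continuous nB).
by exists (state_val u x).
Qed.

Lemma compact_state_gt0 a : is_idempotent a ->
  compact [set s : state_morphism R M | 0 < state_val s a].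
Proof.
move=> aa; pose K : set {ptws M -> U} :=
  [set f : {ptws M -> U} | EMV_homomorphism f /\ \val (f a) = 1].
have cK : compact K.
  apply: subclosed_compact compact_ptws_unit_interval _ => //.
  apply: closedI closed_EMV_homomorphism _.
  apply: (@closed_eq_fun R {ptws M -> U} (fun f => \val (f a)) (cst 1)).
    exact: eval_continuous.
  exact: cst_continuous.
have -> : [set s : state_morphism R M | 0 < state_val s a] = \val @^-1` K.
  apply/seteqP; split=> s /=.
    by move/(state_val_gt0 s aa); split=> //; case: (state_morphismP s).
  by move=> [_ s1]; apply/state_val_gt0.
apply: compact_initial => // f [hf fa1].
have sf : is_state_morphism f by split=> //; exists a.
by exists (exist _ f (mem_set sf)).
Qed.

Lemma clopen_state_gt0 a : is_idempotent a ->
  clopen [set s : state_morphism R M | 0 < state_val s a].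
Proof.
move=> aa; split; last first.
  apply: compact_closed; first exact: state_morphism_hausdorff.
  exact: compact_state_gt0.
have : open [set r : R | 0 < r] by exact: open_gt.
by apply: open_comp => s _; exact: state_val_continuous.
Qed.

Lemma state_gt0_at_idempotent (s : state_morphism R M) :
  exists2 a, is_idempotent a & 0 < state_val s a.
Proof.
have [_ [x sx]] := state_morphismP s; have [a aa xa] := le_idempotent x.
by exists a => //; apply: lt_le_trans (state_val_le s xa); rewrite /state_val sx.
Qed.

End StateMorphismTopology.

(** * Local compactness from the sets attached to idempotents *)

Lemma locally_compact_clopen (T : topologicalType) :
  (forall x : T, exists U, [/\ U x, compact U & clopen U]) ->
  locally_compact [set: T].
Proof.
move=> cl x _; have [U [Ux cU [oU clU]]] := cl x; exists U => //.
by apply: filterS (open_nbhs_nbhs (conj oU Ux)) => y Uy _.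
Qed.

Theorem theorem4p10 (R : realType) (d : Order.disp_t) (M : emvType d) :
  [/\ hausdorff_space (state_morphism R M) /\
        locally_compact [set: state_morphism R M],
      hausdorff_space (maximal_ideal M) /\
        locally_compact [set: maximal_ideal M],
      (forall a : M, is_idempotent a ->
        (compact [set s : state_morphism R M | 0 < state_val s a] /\
         clopen [set s : state_morphism R M | 0 < state_val s a]) /\
        (compact [set A : maximal_ideal M | ~ ideal_set A a] /\
         clopen [set A : maximal_ideal M | ~ ideal_set A a])) &
      (exists t : M, forall x : M, (x <= t)%O) ->
        compact [set: state_morphism R M] /\ compact [set: maximal_ideal M]].
Proof.
split.
- split; first exact: state_morphism_hausdorff.
  apply: locally_compact_clopen => s.
  have [a aa sa] := state_gt0_at_idempotent s.
  exists [set s | 0 < state_val s a]; split=> //.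
    exact: compact_state_gt0.
  exact: clopen_state_gt0.
- split; first exact: maximal_ideal_hausdorff.
  apply: locally_compact_clopen => A; have [pA _] := maximal_idealP A.
  have [a [aa _ nAa]] := proper_ideal_misses_idempotent \bot%O pA.
  exists [set A | ~ ideal_set A a]; split=> //.
    exact: compact_hull_kernel_idempotent.
  exact: clopen_hull_kernel_idempotent.
- move=> a aa; split; split.
  + exact: compact_state_gt0.
  + exact: clopen_state_gt0.
  + exact: compact_hull_kernel_idempotent.
  + exact: clopen_hull_kernel_idempotent.
move=> [t t_top].
have tt : is_idempotent t by apply/le_anti; rewrite t_top le_oplusl.
split.
  rewrite (_ : setT = [set s | 0 < state_val s t]).
    exact: compact_state_gt0.
  apply/seteqP; split=> // s _ /=; have [a _ sa] := state_gt0_at_idempotent s.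
  exact: lt_le_trans sa (state_val_le s (t_top a)).
rewrite (_ : setT = [set A | ~ ideal_set A t]).
  exact: compact_hull_kernel_idempotent.
apply/seteqP; split=> // A _ /= At; have [[[_ Ad _] AT] _] := maximal_idealP A.
by apply: AT; apply/seteqP; split=> // x _; exact: Ad (t_top x) At.
Qed.
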